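(* Consider the discrete-time LTI system $x[t+1]=Ax[t]+B_2u[t]+\delta_x[t]$. Let $(\hat{\mathbf{\Phi}}_x,\hat{\mathbf{\Phi}}_u,\mathbf{\Delta})$ be a solution to $$\begin{bmatrix} zI-A & -B_2\end{bmatrix}\begin{bmatrix}\hat{\mathbf{\Phi}}_x\\ \hat{\mathbf{\Phi}}_u\end{bmatrix}=I+\mathbf{\Delta},\qquad \hat{\mathbf{\Phi}}_x,\hat{\mathbf{\Phi}}_u\in\tfrac1z\mathcal{RH}_\infty .$$ Then the controller implementation $$\hat{\boldsymbol{\delta}}_x=\mathbf{x}-\hat{\mathbf{x}},\qquad \mathbf{u}=z\hat{\mathbf{\Phi}}_u\hat{\boldsymbol{\delta}}_x,\qquad \hat{\mathbf{x}}=(z\hat{\mathbf{\Phi}}_x-I)\hat{\boldsymbol{\delta}}_x$$ internally stabilizes the system $(A,B_2)$ if and only if $(I+\mathbf{\Delta})^{-1}$ is stable. Furthermore, the actual system responses achieved are given by $$\begin{bmatrix}\mathbf{x}\\ \mathbf{u}\end{bmatrix}=\begin{bmatrix}\hat{\mathbf{\Phi}}_x\\ \hat{\mathbf{\Phi}}_u\end{bmatrix}(I+\mathbf{\Delta})^{-1}\boldsymbol{\delta}_x .$$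
   Context: Here $x[t]$ is the state, $u[t]$ the control input and $\delta_x[t]$ the disturbance on the state; $A,B_2$ are real matrices. Boldface denotes $z$-transforms of signals and transfer matrices. $\mathcal{RH}_\infty$ is the set of stable (all poles in $|z|<1$) real-rational proper transfer matrices, and ''stable'' for a transfer matrix means belonging to $\mathcal{RH}_\infty$; $\mathbf{G}\in\frac1z\mathcal{RH}_\infty$ means $z\mathbf{G}\in\mathcal{RH}_\infty$. Internal stability of the implementation means: with external perturbations $\boldsymbol{\delta}_x,\boldsymbol{\delta}_y,\boldsymbol{\delta}_u$ on the state, the measurement and the control action, so that $$(zI-A)\mathbf{x}=B_2\mathbf{u}+\boldsymbol{\delta}_x,\qquad \mathbf{u}=z\hat{\mathbf{\Phi}}_u\hat{\boldsymbol{\delta}}_x+\boldsymbol{\delta}_u,\qquad \mathbf{x}=z\hat{\mathbf{\Phi}}_x\hat{\boldsymbol{\delta}}_x-\boldsymbol{\delta}_y,$$ all nine closed-loop transfer matrices from $(\boldsymbol{\delta}_x,\boldsymbol{\delta}_y,\boldsymbol{\delta}_u)$ to $(\mathbf{x},\mathbf{u},\hat{\boldsymbol{\delta}}_x)$ are stable. The achieved system response is the closed-loop map $\boldsymbol{\delta}_x\mapsto(\mathbf{x},\mathbf{u})$ when $\boldsymbol{\delta}_y=0$ and $\boldsymbol{\delta}_u=0$. *)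

(* Defs.v *)
From HB Require Import structures.
From mathcomp Require Import all_boot all_order all_algebra.
From mathcomp Require Import complex reals.

Set Implicit Arguments.
Unset Strict Implicit.
Unset Printing Implicit Defensive.

Import Order.TTheory GRing.Theory Num.Theory.
Local Open Scope ring_scope.

(** Real-rational functions of one variable, and the class RH_infinity *)

Notation ratfun R := {fraction {poly R}}.

Definition zvar (R : realType) : ratfun R := tofrac 'X.

Definition const_tf (R : realType) (m n : nat) (M : 'M[R]_(m, n)) :
  'M[ratfun R]_(m, n) := map_mx (fun a : R => tofrac a%:P) M.

(* [size p] is the degree plus one, so this is deg p <= deg q; the condition
   does not depend on the fraction p / q chosen to represent f. *)
Definition proper (R : realType) (f : ratfun R) : Prop :=
  exists p q : {poly R},
    [/\ q != 0, f = tofrac p / tofrac q & (size p <= size q)%N].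

(* Poles are complex: the roots of the denominator of f in lowest terms. *)
Definition pole (R : realType) (f : ratfun R) (s : R[i]) : Prop :=
  exists p q : {poly R},
    [/\ q != 0, coprimep p q, f = tofrac p / tofrac q
      & root (map_poly (real_complex R) q) s].

Definition RHinf (R : realType) (f : ratfun R) : Prop :=
  proper f /\ forall s : R[i], pole f s -> `|s| < 1.

Definition RHinf_mx (R : realType) (m n : nat)
  (G : 'M[ratfun R]_(m, n)) : Prop := forall i j, RHinf (G i j).

Definition zRHinf_mx (R : realType) (m n : nat)
  (G : 'M[ratfun R]_(m, n)) : Prop := RHinf_mx (zvar R *: G).

Definition stable_inverse (R : realType) (n : nat)
  (G : 'M[ratfun R]_n) : Prop := G \in unitmx /\ RHinf_mx (invmx G).

(** Signals

   The z-transforms of signals are vectors over an arbitrary field extension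
   [iota : R(z) -> L].  L = R((1/z)) contains the z-transforms of all real
   sequences, and L = R(z) gives the rational signals. *)

Definition apply_tf (R : realType) (L : fieldType)
    (iota : {rmorphism ratfun R -> L}) (m n : nat)
    (G : 'M[ratfun R]_(m, n)) (v : 'cV[L]_n) : 'cV[L]_m :=
  map_mx iota G *m v.

Definition plant (R : realType) (L : fieldType)
    (iota : {rmorphism ratfun R -> L}) (n m : nat)
    (A : 'M[R]_n) (B2 : 'M[R]_(n, m))
    (dx : 'cV[L]_n) (x : 'cV[L]_n) (u : 'cV[L]_m) : Prop :=
  apply_tf iota ((zvar R)%:M - const_tf A) x
  = apply_tf iota (const_tf B2) u + dx.

(* The controller maps the measurement y to the control action u, with
   internal signals dhat and xhat. *)
Definition controller (R : realType) (L : fieldType)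
    (iota : {rmorphism ratfun R -> L}) (n m : nat)
    (Phix : 'M[ratfun R]_n) (Phiu : 'M[ratfun R]_(m, n))
    (y : 'cV[L]_n) (u : 'cV[L]_m) (dhat xhat : 'cV[L]_n) : Prop :=
  [/\ dhat = y - xhat,
      u = apply_tf iota (zvar R *: Phiu) dhat
    & xhat = apply_tf iota (zvar R *: Phix - 1%:M) dhat].

(* dx, dy and du perturb the state, the measurement and the control action. *)
Definition closed_loop (R : realType) (L : fieldType)
    (iota : {rmorphism ratfun R -> L}) (n m : nat)
    (A : 'M[R]_n) (B2 : 'M[R]_(n, m))
    (Phix : 'M[ratfun R]_n) (Phiu : 'M[ratfun R]_(m, n))
    (dx dy : 'cV[L]_n) (du : 'cV[L]_m)
    (x : 'cV[L]_n) (u : 'cV[L]_m) (dhat : 'cV[L]_n) : Prop :=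
  plant iota A B2 dx x u /\
  exists (uc : 'cV[L]_m) (xhat : 'cV[L]_n),
    controller iota Phix Phiu (x + dy) uc dhat xhat /\ u = uc + du.

Lemma closed_loopE (R : realType) (L : fieldType)
    (iota : {rmorphism ratfun R -> L}) (n m : nat)
    (A : 'M[R]_n) (B2 : 'M[R]_(n, m))
    (Phix : 'M[ratfun R]_n) (Phiu : 'M[ratfun R]_(m, n))
    (dx dy : 'cV[L]_n) (du : 'cV[L]_m)
    (x : 'cV[L]_n) (u : 'cV[L]_m) (dhat : 'cV[L]_n) :
  closed_loop iota A B2 Phix Phiu dx dy du x u dhat <->
  [/\ apply_tf iota ((zvar R)%:M - const_tf A) x
        = apply_tf iota (const_tf B2) u + dx,
      u = apply_tf iota (zvar R *: Phiu) dhat + du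
    & x = apply_tf iota (zvar R *: Phix) dhat - dy].
Proof.
have xhatE : apply_tf iota (zvar R *: Phix - 1%:M) dhat
             = apply_tf iota (zvar R *: Phix) dhat - dhat.
  by rewrite /apply_tf map_mxB map_mx1 mulmxBl mul1mx.
split.
  move=> [Hp [uc [xhat [[Hd Huc Hxh] Hu]]]]; split=> //; first by rewrite Hu Huc.
  rewrite Hxh xhatE opprB addrCA in Hd.
  move/eqP: Hd; rewrite eq_sym -subr_eq0 addrAC subrr add0r subr_eq0.
  by move=> /eqP <-; rewrite addrK.
move=> [Hp Hu Hx]; split=> //.
exists (apply_tf iota (zvar R *: Phiu) dhat),
       (apply_tf iota (zvar R *: Phix - 1%:M) dhat); split=> //; split=> //.
by rewrite xhatE Hx subrK opprB addrC subrK.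
Qed.

(* T is the closed-loop transfer matrix, split into nine blocks, from
   (dx, dy, du) to (x, u, dhat).  The equivalence says that the loop is
   well posed: every perturbation has exactly one solution, given by T. *)
Definition closed_loop_tf (R : realType) (L : fieldType)
    (iota : {rmorphism ratfun R -> L}) (n m : nat)
    (A : 'M[R]_n) (B2 : 'M[R]_(n, m))
    (Phix : 'M[ratfun R]_n) (Phiu : 'M[ratfun R]_(m, n))
    (T : 'M[ratfun R]_(n + (m + n), n + (n + m))) : Prop :=
  forall (dx dy : 'cV[L]_n) (du : 'cV[L]_m)
         (x : 'cV[L]_n) (u : 'cV[L]_m) (dhat : 'cV[L]_n),
    closed_loop iota A B2 Phix Phiu dx dy du x u dhat <->
    col_mx x (col_mx u dhat) = apply_tf iota T (col_mx dx (col_mx dy du)).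

Definition internally_stabilizes (R : realType) (L : fieldType)
    (iota : {rmorphism ratfun R -> L}) (n m : nat)
    (A : 'M[R]_n) (B2 : 'M[R]_(n, m))
    (Phix : 'M[ratfun R]_n) (Phiu : 'M[ratfun R]_(m, n)) : Prop :=
  exists T : 'M[ratfun R]_(n + (m + n), n + (n + m)),
    closed_loop_tf iota A B2 Phix Phiu T /\ RHinf_mx T.

Definition system_response (R : realType) (L : fieldType)
    (iota : {rmorphism ratfun R -> L}) (n m : nat)
    (A : 'M[R]_n) (B2 : 'M[R]_(n, m))
    (Phix : 'M[ratfun R]_n) (Phiu : 'M[ratfun R]_(m, n))
    (T : 'M[ratfun R]_(n + m, n)) : Prop :=
  forall (dx x : 'cV[L]_n) (u : 'cV[L]_m),
    (exists dhat : 'cV[L]_n, closed_loop iota A B2 Phix Phiu dx 0 0 x u dhat)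
    <-> col_mx x u = apply_tf iota T dx.

(* Main.v *)
(** Eliminating [x] and [u] from the loop equations leaves
    [z (I + Delta) dhat = dx + (z I - A) dy + B2 du].  If [I + Delta] has a
    stable inverse, this yields all nine closed-loop maps as sums and products
    of stable ones, because [z^-1 (z I - A) = I - z^-1 A].  Conversely, the
    perturbations [dx = A e], [dy = e], [du = 0] make the right-hand side [z e],
    so [(I + Delta) dhat = e]: the combination [T31 A + T32] of the stable
    closed-loop maps to [dhat] is the inverse of [I + Delta]. *)

Require Import Defs.
From HB Require Import structures.
From mathcomp Require Import all_boot all_order all_algebra.
From mathcomp Require Import complex reals.

Import Order.TTheory GRing.Theory Num.Theory.
Local Open Scope ring_scope.

(** * Stable proper rational functions form a ring, and so do matrices over it *)

Lemma tofrac_div_eq (K : fieldType) (p q p' q' : {poly K}) :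
  q != 0 -> q' != 0 ->
  tofrac p / tofrac q = tofrac p' / tofrac q' -> p * q' = p' * q.
Proof.
move=> q0 q'0 /eqP.
by rewrite eqr_div ?tofrac_eq0 // -!tofracM tofrac_eq => /eqP ->.
Qed.

(** One fraction, not necessarily in lowest terms, certifies both properness and stability, so sums
    and products can be treated without reducing them. Cancelling the gcd lowers both degrees
    equally; conversely, the reduced denominator divides any other one, so every pole is a root of
    [q]. *)
Lemma RHinfP (R : realType) (f : ratfun R) :
  RHinf f <-> exists p q : {poly R},
    [/\ q != 0, f = tofrac p / tofrac q, (size p <= size q)%N
      & forall s : R[i], root (map_poly (real_complex R) q) s -> `|s| < 1].
Proof.
split.
  case=> [[p [q [q0 fE le_pq]]] stab].
  pose g := gcdp p q.
  have g0 : g != 0 by rewrite gcdp_eq0 (negbTE q0) andbF.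
  have pE : p = p %/ g * g by rewrite divpK ?dvdp_gcdl.
  have qE : q = q %/ g * g by rewrite divpK ?dvdp_gcdr.
  have q'0 : q %/ g != 0.
    by apply: contraNneq q0 => q'0; rewrite qE q'0 mul0r.
  have fE' : f = tofrac (p %/ g) / tofrac (q %/ g).
    by rewrite fE {1}pE {1}qE !tofracM -mulf_div divff ?mulr1 // tofrac_eq0.
  exists (p %/ g), (q %/ g); split=> //.
    by rewrite !size_divp // leq_sub2r.
  move=> s rs; apply: stab; exists (p %/ g), (q %/ g); split=> //.
  by rewrite coprimep_div_gcd // q0 orbT.
case=> p [q [q0 fE le_pq stab]]; split; first by exists p, q.
move=> s [p' [q' [q'0 cop fE' rs]]]; apply: stab.
have E : p * q' = p' * q by apply: tofrac_div_eq => //; rewrite -fE.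
(* Gauss: [q'] divides [p' * q] and is coprime to [p']. *)
have /dvdpP[r ->] : q' %| q.
  by rewrite -(Gauss_dvdpr q (_ : coprimep q' p')) 1?coprimep_sym // -E dvdp_mull.
by rewrite rmorphM rootM rs orbT.
Qed.

(** Over the denominator [q * q'], neither cross product exceeds it in degree, and its roots are
    those of [q] and [q']. *)
Lemma RHinfD (R : realType) (f g : ratfun R) :
  RHinf f -> RHinf g -> RHinf (f + g).
Proof.
move=> /RHinfP[p [q [q0 -> le_pq sq]]] /RHinfP[p' [q' [q'0 -> le_pq' sq']]].
apply/RHinfP; exists (p * q' + p' * q), (q * q'); split.
- by rewrite mulf_neq0.
- by rewrite addf_div ?tofrac_eq0 // !tofracD !tofracM.
- rewrite (size_mul q0 q'0); apply: leq_trans (size_polyD _ _) _.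
  rewrite geq_max; apply/andP; split; apply: leq_trans (size_polyMleq _ _) _.
    by rewrite -!subn1 leq_sub2r // leq_add2r.
  by rewrite addnC -!subn1 leq_sub2r // leq_add2l.
- by move=> s; rewrite rmorphM rootM => /orP[/sq|/sq'].
Qed.

Lemma RHinfM (R : realType) (f g : ratfun R) :
  RHinf f -> RHinf g -> RHinf (f * g).
Proof.
move=> /RHinfP[p [q [q0 -> le_pq sq]]] /RHinfP[p' [q' [q'0 -> le_pq' sq']]].
apply/RHinfP; exists (p * p'), (q * q'); split.
- by rewrite mulf_neq0.
- by rewrite mulf_div !tofracM.
- rewrite (size_mul q0 q'0); apply: leq_trans (size_polyMleq _ _) _.
  by rewrite -!subn1 leq_sub2r // leq_add.
- by move=> s; rewrite rmorphM rootM => /orP[/sq|/sq'].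
Qed.

Lemma RHinf_const (R : realType) (a : R) : RHinf (tofrac a%:P).
Proof.
apply/RHinfP; exists a%:P, 1; split.
- exact: oner_neq0.
- by rewrite tofrac1 divr1.
- by rewrite size_poly1 size_polyC_leq1.
- by move=> s; rewrite rmorph1 (negbTE (root1 s)).
Qed.

(** The only pole is the origin. This is what makes $I - z^{-1}A$ stable although $zI - A$ is
    improper. *)
Lemma RHinf_zvarV (R : realType) : RHinf (zvar R)^-1.
Proof.
apply/RHinfP; exists 1, 'X; split.
- by rewrite polyX_eq0.
- by rewrite tofrac1 div1r.
- by rewrite size_poly1 size_polyX.
- by move=> s; rewrite map_polyX rootX => /eqP ->; rewrite normr0 ltr01.
Qed.

Lemma RHinf0 (R : realType) : RHinf (0 : ratfun R).
Proof. by have := RHinf_const R 0; rewrite polyC0 tofrac0. Qed.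

Lemma RHinf1 (R : realType) : RHinf (1 : ratfun R).
Proof. by have := RHinf_const R 1; rewrite polyC1 tofrac1. Qed.

Lemma RHinfN (R : realType) (f : ratfun R) : RHinf f -> RHinf (- f).
Proof.
move=> sf; rewrite -mulN1r; apply: RHinfM => //.
by have := RHinf_const R (-1); rewrite polyCN polyC1 tofracN tofrac1.
Qed.

Lemma RHinf_mxD (R : realType) (m n : nat) (F G : 'M[ratfun R]_(m, n)) :
  RHinf_mx F -> RHinf_mx G -> RHinf_mx (F + G).
Proof. by move=> sF sG i j; rewrite mxE; apply: RHinfD. Qed.

Lemma RHinf_mxB (R : realType) (m n : nat) (F G : 'M[ratfun R]_(m, n)) :
  RHinf_mx F -> RHinf_mx G -> RHinf_mx (F - G).
Proof. by move=> sF sG i j; rewrite !mxE; apply/RHinfD/RHinfN. Qed.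

Lemma RHinf_mxZ (R : realType) (m n : nat) (f : ratfun R)
    (G : 'M[ratfun R]_(m, n)) :
  RHinf f -> RHinf_mx G -> RHinf_mx (f *: G).
Proof. by move=> sf sG i j; rewrite mxE; apply: RHinfM. Qed.

Lemma RHinf_mxM (R : realType) (m n p : nat) (F : 'M[ratfun R]_(m, n))
    (G : 'M[ratfun R]_(n, p)) :
  RHinf_mx F -> RHinf_mx G -> RHinf_mx (F *m G).
Proof.
move=> sF sG i j; rewrite mxE; elim/big_ind: _; first exact: RHinf0.
  exact: RHinfD.
by move=> k _; apply: RHinfM.
Qed.

Lemma RHinf_mx0 (R : realType) (m n : nat) :
  RHinf_mx (0 : 'M[ratfun R]_(m, n)).
Proof. by move=> i j; rewrite mxE; apply: RHinf0. Qed.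

Lemma RHinf_mx1 (R : realType) (n : nat) : RHinf_mx (1%:M : 'M[ratfun R]_n).
Proof. by move=> i j; rewrite mxE; case: eqP => _; [apply: RHinf1|apply: RHinf0]. Qed.

Lemma RHinf_const_tf (R : realType) (m n : nat) (M : 'M[R]_(m, n)) :
  RHinf_mx (const_tf M).
Proof. by move=> i j; rewrite mxE; apply: RHinf_const. Qed.

Lemma RHinf_row_mx (R : realType) (m n1 n2 : nat) (F : 'M[ratfun R]_(m, n1))
    (G : 'M[ratfun R]_(m, n2)) :
  RHinf_mx F -> RHinf_mx G -> RHinf_mx (row_mx F G).
Proof. by move=> sF sG i j; rewrite mxE; case: split. Qed.

Lemma RHinf_col_mx (R : realType) (m1 m2 n : nat) (F : 'M[ratfun R]_(m1, n))
    (G : 'M[ratfun R]_(m2, n)) :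
  RHinf_mx F -> RHinf_mx G -> RHinf_mx (col_mx F G).
Proof. by move=> sF sG i j; rewrite mxE; case: split. Qed.

Lemma zvar_neq0 (R : realType) : zvar R != 0.
Proof. by rewrite tofrac_eq0 polyX_eq0. Qed.

Lemma invmx_scale (K : fieldType) (n : nat) (a : K) (M : 'M[K]_n) :
  a != 0 -> M \in unitmx -> invmx (a *: M) = a^-1 *: invmx M.
Proof. by move=> a0 uM; rewrite invmxZ // unitmxZ ?unitfE. Qed.

Lemma scale_invmx (K : fieldType) (n : nat) (a : K) (M : 'M[K]_n) :
  a != 0 -> M \in unitmx -> a *: invmx (a *: M) = invmx M.
Proof. by move=> a0 uM; rewrite invmx_scale // scalerA divff // scale1r. Qed.

(** * Transfer matrices acting on signals *)

Section ApplyTF.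
Context (R : realType) (L : fieldType) (iota : {rmorphism ratfun R -> L}).

Lemma apply_tfDr m n (G : 'M_(m, n)) (v w : 'cV_n) :
  apply_tf iota G (v + w) = apply_tf iota G v + apply_tf iota G w.
Proof. exact: mulmxDr. Qed.

Lemma apply_tfBr m n (G : 'M_(m, n)) (v w : 'cV_n) :
  apply_tf iota G (v - w) = apply_tf iota G v - apply_tf iota G w.
Proof. exact: mulmxBr. Qed.

Lemma apply_tf0r m n (G : 'M_(m, n)) : apply_tf iota G 0 = 0.
Proof. exact: mulmx0. Qed.

Lemma apply_tf0 m n (v : 'cV_n) : apply_tf iota (0 : 'M_(m, n)) v = 0.
Proof. by rewrite /apply_tf map_mx0 mul0mx. Qed.

Lemma apply_tf1 n (v : 'cV_n) : apply_tf iota 1%:M v = v.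
Proof. by rewrite /apply_tf map_mx1 mul1mx. Qed.

Lemma apply_tfD m n (F G : 'M_(m, n)) v :
  apply_tf iota (F + G) v = apply_tf iota F v + apply_tf iota G v.
Proof. by rewrite /apply_tf map_mxD mulmxDl. Qed.

Lemma apply_tfB m n (F G : 'M_(m, n)) v :
  apply_tf iota (F - G) v = apply_tf iota F v - apply_tf iota G v.
Proof. by rewrite /apply_tf map_mxB mulmxBl. Qed.

Lemma apply_tfM m n p (F : 'M_(m, n)) (G : 'M_(n, p)) v :
  apply_tf iota (F *m G) v = apply_tf iota F (apply_tf iota G v).
Proof. by rewrite /apply_tf map_mxM mulmxA. Qed.

Lemma apply_tf_row_mx m n1 n2 (F : 'M_(m, n1)) (G : 'M_(m, n2)) v w :
  apply_tf iota (row_mx F G) (col_mx v w) = apply_tf iota F v + apply_tf iota G w.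
Proof. by rewrite /apply_tf map_row_mx mul_row_col. Qed.

Lemma apply_tf_col_mx m1 m2 n (F : 'M_(m1, n)) (G : 'M_(m2, n)) v :
  apply_tf iota (col_mx F G) v = col_mx (apply_tf iota F v) (apply_tf iota G v).
Proof. by rewrite /apply_tf map_col_mx mul_col_mx. Qed.

Lemma apply_tf_unit n (G : 'M_n) v w : G \in unitmx ->
  apply_tf iota G v = w <-> v = apply_tf iota (invmx G) w.
Proof.
by move=> uG; split=> [<-|->]; rewrite -apply_tfM ?mulVmx ?mulmxV // apply_tf1.
Qed.

(** Standard basis vectors read off the columns, and [iota] is injective as a morphism out of a
    field. Identities between signals over [L] thus descend to transfer matrices. *)
Lemma apply_tf_inj m n (F G : 'M_(m, n)) :
  (forall v, apply_tf iota F v = apply_tf iota G v) -> F = G.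
Proof.
move=> FG; apply: (map_mx_inj (f := iota)); apply/matrixP => i j.
by have /colP/(_ i) := FG (delta_mx j 0); rewrite /apply_tf -!colE !mxE.
Qed.

(** Since [x] and [u] are explicit in [dhat], substituting them into the plant equation leaves one
    equation for [dhat]; the scalar $z$ commutes with all matrices and collects in front of [M]. *)
Lemma closed_loop_elim n m (A : 'M[R]_n) (B2 : 'M[R]_(n, m))
    (Phix : 'M[ratfun R]_n) (Phiu : 'M[ratfun R]_(m, n)) dx dy du x u dhat
    (M := ((zvar R)%:M - const_tf A) *m Phix - const_tf B2 *m Phiu) :
  closed_loop iota A B2 Phix Phiu dx dy du x u dhat <->
  [/\ x = apply_tf iota (zvar R *: Phix) dhat - dy,
      u = apply_tf iota (zvar R *: Phiu) dhat + du
    & apply_tf iota (zvar R *: M) dhat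
      = dx + apply_tf iota ((zvar R)%:M - const_tf A) dy
           + apply_tf iota (const_tf B2) du].
Proof.
(* Used with $a = (zI-A)z\Phi_x\hat\delta$, $b = (zI-A)\delta_y$, $c = B_2 z\Phi_u\hat\delta$, $d =
   B_2\delta_u$, $e = \delta_x$. *)
have rearrange (V : zmodType) (a b c d e : V) :
    a - b = c + d + e <-> a - c = e + b + d.
  have E : (a - b == c + d + e) = (a - c == e + b + d).
    by rewrite !subr_eq [X in _ == X](ACl (3*4*2*1))%AC.
  by split=> /eqP eq_ab; apply/eqP; rewrite ?E // -E.
rewrite closed_loopE /M scalerBr !scalemxAr (apply_tfB _ _ (_ *m _)) !apply_tfM.
by split=> [[+ uE xE]|[xE uE +]]; rewrite xE uE apply_tfBr apply_tfDr;
   [move=> /(iffLR (rearrange _ _ _ _ _ _))|move=> /(iffRL (rearrange _ _ _ _ _ _))].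
Qed.

End ApplyTF.

Theorem theorem4p3 (R : realType) (L : fieldType)
    (iota : {rmorphism ratfun R -> L}) (n m : nat)
    (A : 'M[R]_n) (B2 : 'M[R]_(n, m))
    (Phix : 'M[ratfun R]_n) (Phiu : 'M[ratfun R]_(m, n))
    (Delta : 'M[ratfun R]_n)
    (affine : row_mx ((zvar R)%:M - const_tf A) (- const_tf B2)
                *m col_mx Phix Phiu = 1%:M + Delta)
    (Phix_stable : zRHinf_mx Phix) (Phiu_stable : zRHinf_mx Phiu) :
  (internally_stabilizes iota A B2 Phix Phiu <-> stable_inverse (1%:M + Delta))
  /\
  (1%:M + Delta \in unitmx ->
   system_response iota A B2 Phix Phiu
     (col_mx Phix Phiu *m invmx (1%:M + Delta))).
Proof.
set M := 1%:M + Delta; set z := zvar R.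
have z0 : z != 0 := zvar_neq0 R.
have ME : (z%:M - const_tf A) *m Phix - const_tf B2 *m Phiu = M.
  by rewrite /M -affine mul_row_col mulNmx.
have uzM : M \in unitmx -> z *: M \in unitmx by rewrite unitmxZ ?unitfE.
split; last first.
  move=> uM dx x u.
  have invE : z *: invmx (z *: M) = invmx M :=
    scale_invmx _ _ _ _ z0 uM.
  (* With [dy] and [du] zero the loop gives [dhat] as $(zM)^{-1}\delta_x$, and the factor $z$ in the
     maps from [dhat] to [x] and [u] cancels. *)
  have respE : col_mx Phix Phiu *m invmx M
             = col_mx (z *: Phix *m invmx (z *: M)) (z *: Phiu *m invmx (z *: M)).
    by rewrite mul_col_mx -!scalemxAl !scalemxAr invE.
  rewrite respE apply_tf_col_mx !apply_tfM.
  split=> [[dhat /closed_loop_elim[]]|/eq_col_mx[-> ->]].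
    rewrite ME !apply_tf0r !addr0 subr0 => -> ->.
    by move=> /(apply_tf_unit _ _ _ _ _ _ _ (uzM uM)) ->.
  exists (apply_tf iota (invmx (z *: M)) dx); apply/closed_loop_elim.
  rewrite ME !apply_tf0r !addr0 subr0; split=> //.
  exact/(apply_tf_unit _ _ _ _ _ _ _ (uzM uM)).
split.
  case=> T [T_loop T_stable].
  (* [C] sends $e$ to the perturbation $(Ae, e, 0)$, so [N] is $T_{31}A + T_{32}$. *)
  pose C : 'M[ratfun R]_(n + (n + m), n) := col_mx (const_tf A) (col_mx 1%:M 0).
  pose N := dsubmx (dsubmx T) *m C.
  have N_stable : RHinf_mx N.
    apply: RHinf_mxM => [i j|]; first by rewrite !mxE; apply: T_stable.
    apply: RHinf_col_mx; first exact: RHinf_const_tf.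
    by apply: RHinf_col_mx; [apply: RHinf_mx1|apply: RHinf_mx0].
  have MN : M *m N = 1%:M.
    have: z *: (M *m N) = z *: 1%:M.
      apply: (apply_tf_inj _ _ iota) => e.
      pose w := apply_tf iota C e.
      have wE : w = col_mx (apply_tf iota (const_tf A) e) (col_mx e 0).
        by rewrite /w /C !apply_tf_col_mx apply_tf1 apply_tf0.
      (* The output of [T] itself solves the loop, so its last block satisfies $zM\hat\delta = Ae +
         (zI-A)e = ze$. *)
      have := T_loop (apply_tf iota (const_tf A) e) e 0
        (apply_tf iota (usubmx T) w) (apply_tf iota (usubmx (dsubmx T)) w)
        (apply_tf iota (dsubmx (dsubmx T)) w).
      rewrite -wE -!apply_tf_col_mx !vsubmxK => -[_ /(_ erefl)].
      move=> /closed_loop_elim[_ _].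
      rewrite ME apply_tf0r addr0 apply_tfB addrC subrK scalemxAl.
      by rewrite scalemx1 /N !apply_tfM.
    by move/(scalerI z0).
  (* For square matrices a right inverse is the inverse, so [invmx M] is the stable matrix [N]. *)
  have [uM _] := mulmx1_unit MN; split=> //.
  by rewrite -[invmx M]mulmx1 -MN mulKmx.
case=> uM sM.
(* [K] collects the coefficients of the perturbations in the equation for [dhat], and [D] is the
   resulting closed-loop map to [dhat]. *)
pose K := row_mx 1%:M (row_mx (z%:M - const_tf A) (const_tf B2)).
pose D := invmx (z *: M) *m K.
have D_stable : RHinf_mx D.
  (* [K] is improper because of $zI - A$; the factor $z^{-1}$ of $(zM)^{-1}$ is moved onto it,
     leaving [invmx M] times a stable matrix. *)
  rewrite /D (invmx_scale _ _ _ _ z0 uM) -scalemxAl scalemxAr; apply: RHinf_mxM => //.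
  have zVz : z^-1 *: (z%:M : 'M_n) = 1%:M by rewrite scale_scalar_mx (mulVf z0).
  rewrite !scale_row_mx scalerBr zVz.
  have sz := RHinf_zvarV R.
  apply: RHinf_row_mx; first exact/RHinf_mxZ/RHinf_mx1.
  apply: RHinf_row_mx; last exact/RHinf_mxZ/RHinf_const_tf.
  by apply: RHinf_mxB; [apply: RHinf_mx1|exact/RHinf_mxZ/RHinf_const_tf].
(* The block rows are $z\Phi_x D$ and $z\Phi_u D$, corrected by the direct terms $-\delta_y$ and
   $+\delta_u$, and then [D]. *)
exists (col_mx (z *: Phix *m D - row_mx 0 (row_mx 1%:M 0))
       (col_mx (z *: Phiu *m D + row_mx 0 (row_mx 0 1%:M)) D)); split.
  move=> dx dy du x u dhat.
  rewrite closed_loop_elim ME !apply_tf_col_mx.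
  rewrite (apply_tfB _ _ _ _ _ (_ *m _)) (apply_tfD _ _ _ _ _ (_ *m _)).
  rewrite !(apply_tfM _ _ _ _ _ _ (_ *: _) D) !apply_tf_row_mx.
  rewrite !apply_tf0 !apply_tf1 !add0r addr0.
  have -> : dx + apply_tf iota (z%:M - const_tf A) dy + apply_tf iota (const_tf B2) du
          = apply_tf iota K (col_mx dx (col_mx dy du)).
    by rewrite /K !apply_tf_row_mx apply_tf1 addrA.
  have dhatE := apply_tf_unit _ _ iota _ _ dhat
    (apply_tf iota K (col_mx dx (col_mx dy du))) (uzM uM).
  rewrite -apply_tfM -/D in dhatE.
  split=> [[-> ->]|/eq_col_mx[-> /eq_col_mx[-> dE]]].
    by move=> /(iffLR dhatE) ->.
  by rewrite -dE; split=> //; apply: (iffRL dhatE).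
(* The products are stable because $z\Phi_x$ and $z\Phi_u$ are, which is what membership in
   $\frac1z\mathcal{RH}_\infty$ provides. *)
have [s0 s1] := (RHinf_mx0 R, RHinf_mx1 R).
apply: RHinf_col_mx; last apply: RHinf_col_mx => //.
  apply: RHinf_mxB; first exact: RHinf_mxM.
  apply: RHinf_row_mx; [exact: s0|apply: RHinf_row_mx; [exact: s1|exact: s0]].
apply: RHinf_mxD; first exact: RHinf_mxM.
apply: RHinf_row_mx; [exact: s0|apply: RHinf_row_mx; [exact: s0|exact: s1]].
Qed.
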